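(* Let $n,k,t$ be integers with $t\ge1$, $k\ge1$ and $n\ge kt$. Then the Leray number (over a field $K$) of $\Delta_{n,t}^{[k]}$ is $$L\left(\Delta_{n,t}^{[k]}\right)=\begin{cases} n-kt & \text{if } kt\le n\le k(t+1);\\[0.4em] \dfrac{2(n-d)}{t+1}-k & \text{if } n\equiv d\pmod{t+1} \text{ with } 0\le d\le t-1, \text{ and } n>k(t+1);\\[0.8em] \dfrac{2(n+1)}{t+1}-k-1 & \text{if } n\equiv t\pmod{t+1} \text{ and } n>k(t+1).\end{cases}$$
   Context: A simplicial complex $\Delta$ is $d$-Leray over $K$ if $\widetilde H_i(\Gamma;K)=0$ for all induced subcomplexes $\Gamma\subset\Delta$ (i.e. $\Gamma=\{\sigma\in\Delta:\sigma\subseteq W\}$ for a set $W$ of vertices) and all $i\ge d$. The Leray number $L(\Delta)$ is the minimum integer $d\geq 0$ such that $\Delta$ is $d$-Leray over $K$. Let $R=K[x_1,\dots,x_n]$, $[n]=\{1,\dots,n\}$. The $t$-path ideal $I_{n,t}$ of the path graph on $[n]$ is generated by $x_ix_{i+1}\cdots x_{i+t-1}$ for $1\le i\le n-t+1$. The $k$-th squarefree power $I_{n,t}^{[k]}$ is generated by the squarefree monomials in the minimal generating set of $I_{n,t}^k$, i.e. by products of $k$ of these generators with pairwise disjoint supports. Its Stanley--Reisner complex $\Sigma_{n,t}^{[k]}$ consists of the $F\subseteq[n]$ with $\prod_{i\in F}x_i\notin I_{n,t}^{[k]}$, and $\Delta_{n,t}^{[k]}=\{[n]\setminus F: F\subseteq[n],\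 F\notin\Sigma_{n,t}^{[k]}\}$ is its Alexander dual. *)

(* Defs.v *)
From HB Require Import structures.
From mathcomp Require Import all_boot all_order all_algebra.
From mathcomp Require Import boolp.
From mathcomp Require Import mpoly.

Set Implicit Arguments.
Unset Strict Implicit.
Unset Printing Implicit Defensive.

Import GRing.Theory.
Local Open Scope ring_scope.

(* The ground set [n] = {1, ..., n} is 'I_n; the variable x_(i+1) is 'X_i. *)

(* Not every point of 'I_n need be a vertex, and the void complex (without even
   the empty face) is allowed. *)
Record simplicial_complex (n : nat) := SimplicialComplex {
  faces :> {set {set 'I_n}};
  faces_down : forall F G : {set 'I_n}, G \subset F -> F \in faces -> G \in faces
}.

Section Complexes.
Variable n : nat.
Implicit Type D : simplicial_complex n.

Fact induced_down D (W F G : {set 'I_n}) :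
  G \subset F -> F \in [set A in faces D | A \subset W] ->
  G \in [set A in faces D | A \subset W].
Proof.
rewrite !inE => sGF /andP[FD sFW].
by rewrite (faces_down sGF FD) (subset_trans sGF sFW).
Qed.

Definition induced D (W : {set 'I_n}) : simplicial_complex n :=
  SimplicialComplex (@induced_down D W).

Fact alexander_dual_down D (F G : {set 'I_n}) :
  G \subset F -> F \in [set ~: A | A in ~: faces D] ->
  G \in [set ~: A | A in ~: faces D].
Proof.
move=> sGF /imsetP[A]; rewrite inE => AnD defF.
apply/imsetP; exists (~: G); last by rewrite setCK.
rewrite inE; apply: contra AnD; apply: faces_down.
by rewrite -(setCK A) -defF setCS.
Qed.

Definition alexander_dual D : simplicial_complex n :=
  SimplicialComplex (@alexander_dual_down D).

End Complexes.

Section ReducedHomology.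
Variables (K : fieldType) (n : nat).
Implicit Type D : simplicial_complex n.

(* All chains over K on the full simplex with vertex set 'I_n, in all degrees at
   once. *)
Definition chain := {ffun {set 'I_n} -> K^o}.

Definition basis_chain (F : {set 'I_n}) : chain := [ffun G => (G == F)%:R].

(* F = {v_0 < ... < v_i} is sent to the sum of the (-1)^j (F minus v_j); the
   boundary of a vertex is the empty face, hence reduced homology. *)
Definition face_boundary (F : {set 'I_n}) : chain :=
  \sum_(v in F) (-1) ^+ #|[set w in F | (w < v)%N]| *: basis_chain (F :\ v).

Definition boundary (c : chain) : chain := \sum_F (c F : K) *: face_boundary F.

Fact boundary_is_linear : linear boundary.
Proof.
move=> a c d; rewrite /boundary scaler_sumr -big_split /=.
by apply: eq_bigr => F _; rewrite !ffunE scalerDl scalerA.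
Qed.

HB.instance Definition _ :=
  GRing.isLinear.Build K chain chain _ boundary boundary_is_linear.

Definition chains_of_card D (m : nat) : {vspace chain} :=
  (\sum_(F in faces D | #|F| == m) <[basis_chain F]>)%VS.

(* i-dimensional faces have i + 1 elements *)
Definition cycles D (i : nat) : {vspace chain} :=
  (chains_of_card D i.+1 :&: lker (linfun boundary))%VS.

Definition boundaries D (i : nat) : {vspace chain} :=
  (linfun boundary @: chains_of_card D i.+2)%VS.

(* Vanishing of the quotient cycles / boundaries.  Only degrees i >= 0 are
   covered, since Leray numbers are nonnegative. *)
Definition reduced_homology_vanishes D (i : nat) : Prop :=
  (cycles D i <= boundaries D i)%VS.

Definition is_leray D (d : nat) : Prop :=
  forall (W : {set 'I_n}) (i : nat),
    (d <= i)%N -> reduced_homology_vanishes (induced D W) i.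

Fact leray_exists D : exists d : nat, `[< is_leray D d >].
Proof.
exists n; apply/asboolP => W i le_ni; rewrite /reduced_homology_vanishes /cycles.
suff -> : chains_of_card (induced D W) i.+1 = 0%VS by rewrite cap0v sub0v.
rewrite /chains_of_card big_pred0 // => F.
apply/negbTE/nandP; right; apply/eqP => cardF; have := max_card (mem F).
by rewrite cardF card_ord ltnNge le_ni.
Qed.

Definition leray_number D : nat := ex_minn (leray_exists D).

End ReducedHomology.

Section MonomialIdeals.
Variables (K : fieldType) (n : nat).

Definition sqfree_monomial (F : {set 'I_n}) : {mpoly K[n]} := \prod_(i in F) 'X_i.

Definition ideal_gen (S : {mpoly K[n]} -> Prop) (p : {mpoly K[n]}) : Prop :=
  exists s : seq ({mpoly K[n]} * {mpoly K[n]}),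
    (forall u, u \in s -> S u.2) /\ p = \sum_(u <- s) u.1 * u.2.

Fact ideal_gen_mull (S : {mpoly K[n]} -> Prop) p q :
  ideal_gen S p -> ideal_gen S (q * p).
Proof.
case=> s [sS ->]; exists [seq (q * u.1, u.2) | u <- s]; split.
  by move=> _ /mapP[u /sS Su ->].
by rewrite big_map mulr_sumr; apply: eq_bigr => u _; rewrite mulrA.
Qed.

Fact stanley_reisner_down (S : {mpoly K[n]} -> Prop) (F G : {set 'I_n}) :
  G \subset F ->
  F \in [set A | ~~ `[< ideal_gen S (sqfree_monomial A) >]] ->
  G \in [set A | ~~ `[< ideal_gen S (sqfree_monomial A) >]].
Proof.
rewrite !inE => sGF; apply: contra => /asboolP SG; apply/asboolP.
have -> : sqfree_monomial F = sqfree_monomial (F :\: G) * sqfree_monomial G.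
  rewrite /sqfree_monomial (big_setID G) /= (setIidPr sGF); exact: mulrC.
exact: ideal_gen_mull.
Qed.

(* The Stanley-Reisner complex of the ideal generated by S. *)
Definition stanley_reisner (S : {mpoly K[n]} -> Prop) : simplicial_complex n :=
  SimplicialComplex (@stanley_reisner_down S).

(* Supports of the generators x_i x_(i+1) ... x_(i+t-1) of the t-path ideal
   (with t >= 1). *)
Definition path_supports (t : nat) : {set {set 'I_n}} :=
  [set [set j : 'I_n | (i <= j < i + t)%N] | i : 'I_n & (i + t <= n)%N].

(* The generators of the k-th squarefree power: products of k generators of the
   t-path ideal with pairwise disjoint supports. *)
Definition path_sqfree_power_gen (t k : nat) (p : {mpoly K[n]}) : Prop :=
  exists F : 'I_k -> {set 'I_n},
    [/\ forall a, F a \in path_supports t,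
        forall a b, a != b -> [disjoint F a & F b]
      & p = \prod_(a < k) sqfree_monomial (F a)].

End MonomialIdeals.

Definition path_complex (K : fieldType) (n t k : nat) : simplicial_complex n :=
  stanley_reisner (@path_sqfree_power_gen K n t k).

Definition path_dual_complex (K : fieldType) (n t k : nat) : simplicial_complex n :=
  alexander_dual (path_complex K n t k).

(* Main.v *)
(* Write D for the dual complex: F is a face of D iff the complement of F contains k disjoint
   blocks of t consecutive points.

   Upper bound.  A complex is d-Leray as soon as all its links have no homology in dimensions
   >= d, and the links of D are complexes of the same kind in which only the vertices in a set A
   may be used.  In such a complex let s be the first vertex and pair F with F + s.  The faces left
   over, those for which deleting s from the complement destroys the packing, all have the block
   [s, s + t) in their complement; splitting them according to the vertex s + t expresses the
   homology through the complexes on the points >= s + t with k - 1 blocks (same dimension), on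
   the points > s + t with k - 1 blocks (dimension shifted by 1) and with k blocks (shifted by 2).
   Maximizing the total shift gives the bound.  Only long exact sequences of relative homology are
   needed; a pair of complexes enters through its difference, a convex family of sets.

   Lower bound.  Cut an initial part of the path into A blocks of length t and B blocks of length
   t + 1, with A + B >= k and fewer than t points left over.  Let W consist of the last point of
   each short block and both end points of each long block.  Every block of t consecutive points
   meets W, so a face of the induced complex on W misses at least k points of W.  Grouping
   consecutive blocks splits W into k parts, and every F in W that misses one point of each part
   is a face.  These F form a join of boundaries of simplices of the top possible dimension
   A + 2 B - k - 1, hence a nonzero homology class. *)

Require Import Defs.
From mathcomp Require Import all_boot all_order all_algebra.
From mathcomp Require Import boolp mpoly zify ring.
Import GRing.Theory.
Local Open Scope ring_scope.

Set Implicit Arguments.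
Unset Strict Implicit.
Unset Printing Implicit Defensive.

(** * Relative chains of convex families *)

Section Chains.
Variables (K : fieldType) (n : nat).
Implicit Types (c e : chain K n) (F G H : {set 'I_n}) (S A B : {set {set 'I_n}}).
Implicit Types (u v : 'I_n) (m : nat).

Definition insertion_sign G v : K := (-1) ^+ #|[set w in G | (w < v)%N]|.

Lemma insertion_sign_sq G v : insertion_sign G v * insertion_sign G v = 1.
Proof. by rewrite /insertion_sign -expr2 sqrr_sign. Qed.

Lemma insertion_signU1 G u v : u \notin G ->
  insertion_sign (u |: G) v = (-1) ^+ (u < v)%N * insertion_sign G v.
Proof.
move=> uG; rewrite /insertion_sign -exprD; congr (_ ^+ _).
case: ltnP => uv.
  rewrite (_ : [set _ in _ | _] = u |: [set w in G | (w < v)%N]).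
    by rewrite cardsU1 inE (negPf uG).
  by apply/setP => w; rewrite !inE; case: eqP => [->|].
congr #|pred_of_set _|; apply/setP => w; rewrite !inE.
by case: eqP => [->|//]; rewrite (negPf uG) ltnNge uv.
Qed.

(** Adding the larger vertex keeps the sign of the smaller one, while adding the smaller vertex
    flips the sign of the larger. *)
Lemma insertion_sign_swap G u v : u != v -> u \notin G -> v \notin G ->
  insertion_sign G v * insertion_sign (v |: G) u =
  - (insertion_sign G u * insertion_sign (u |: G) v).
Proof.
move=> uv uG vG; rewrite !insertion_signU1 //.
have : val u != val v by [].
by case: ltngtP => // _ _; rewrite !expr0 !expr1; ring.
Qed.

Lemma boundaryE c G :
  boundary c G = \sum_(v | v \notin G) insertion_sign G v * c (v |: G).
Proof.
rewrite /boundary sum_ffunE.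
under eq_bigr => F _ do rewrite ffunE /face_boundary sum_ffunE scaler_sumr.
rewrite (exchange_big_dep predT) //= [RHS]big_mkcond /=.
apply: eq_bigr => v _.
under eq_bigr => F _ do rewrite !ffunE.
case: ifPn => vG; last first.
  apply: big1 => F vF; case: eqP => [GF|_]; last by rewrite /GRing.scale /= !mulr0.
  by rewrite GF !inE eqxx in vG.
rewrite (bigD1 (v |: G)) ?setU11 //= setU1K // eqxx big1 => [|F /andP[vF FG]].
  rewrite addr0 /GRing.scale /= mulr1 mulrC /insertion_sign; congr (_ ^+ _ * _).
  apply: eq_card => w; rewrite !inE; case: (eqVneq w v) => [->|//].
  by rewrite ltnn !andbF.
case: eqP => [GF|_]; last by rewrite /GRing.scale /= !mulr0.
by rewrite GF setD1K ?eqxx in FG.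
Qed.

Lemma boundary_boundary c G : boundary (boundary c) G = 0.
Proof.
rewrite boundaryE.
pose f v u := insertion_sign G v * (insertion_sign (v |: G) u * c (u |: (v |: G))).
pose P v u := (v \notin G) && (u \notin G).
transitivity (\sum_v \sum_(u | P v u && (v != u)) f v u).
  rewrite big_mkcond /=; apply: eq_bigr => v _.
  rewrite boundaryE /P; case: (boolP (v \in G)) => vG /=; first by rewrite big_pred0.
  rewrite mulr_sumr; apply: eq_bigl => u; rewrite !inE negb_or eq_sym; exact: andbC.
(* Each unordered pair occurs twice; exchanging the sums in the second half makes the two
   occurrences cancel term by term. *)
transitivity (\sum_v \sum_(u | P v u && (v < u)%N) f v u +
              \sum_v \sum_(u | P v u && (u < v)%N) f v u).
  rewrite -big_split; apply: eq_bigr => v _.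
  rewrite (bigID (fun u : 'I_n => (v < u)%N)) /=; congr (_ + _).
    apply: eq_bigl => u; rewrite -andbA; congr (_ && _).
    by rewrite andbC -val_eqE /=; case: ltngtP.
  apply: eq_bigl => u; rewrite -andbA; congr (_ && _).
  by rewrite -val_eqE /=; case: ltngtP.
rewrite [X in _ + X](exchange_big_dep predT) //= -big_split /=.
rewrite big1 // => v _.
rewrite [X in _ + X](eq_bigl (fun u => P v u && (v < u)%N)); last first.
  by move=> u; rewrite /P andbC [(u \notin G) && _]andbC andbC.
rewrite -big_split big1 // => u /andP[/andP[vG uG] vu] /=.
have uv : u != v by rewrite -val_eqE /=; case: ltngtP vu.
by rewrite /f setUCA !mulrA insertion_sign_swap // mulNr addNr.
Qed.

Definition restriction S c : chain K n := [ffun F => if F \in S then c F else 0].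

Definition supported S m c := forall F, c F != 0 -> (F \in S) && (#|F| == m).

(* For [S] = D \ D' with D' a subcomplex of D, this says that the relative homology of
   (D, D') vanishes in dimension [m - 1]. *)
Definition acyclic_at S m := forall c, supported S m c ->
  (forall G, G \in S -> boundary c G = 0) ->
  exists2 e, supported S m.+1 e & forall G, G \in S -> boundary e G = c G.

(** Convexity makes the boundary truncated to [S] square to zero, so [S] carries a chain complex. A
    relatively down-closed part [A], as in [ideal_of], is a subcomplex whose quotient is carried by
    [S :\: A]. *)
Definition convex_family S := forall F G H, F \in S -> H \in S ->
  F \subset G -> G \subset H -> G \in S.

Definition ideal_of A S := {subset A <= S} /\
  forall F G, F \in A -> G \in S -> G \subset F -> G \in A.

Lemma supported0 S m c F : supported S m c -> F \notin S -> c F = 0.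
Proof. by move=> cS FS; apply/eqP/negPn/negP => /cS/andP[FS']; rewrite FS' in FS. Qed.

Lemma supported_restriction S A m c :
  supported S m c -> supported A m (restriction A c).
Proof.
by move=> cS F; rewrite ffunE; case: ifP => [_ /cS/andP[]|]; rewrite ?eqxx.
Qed.

Lemma supported_sub S A m c : {subset A <= S} -> supported A m c -> supported S m c.
Proof. by move=> sAS cA F /cA/andP[/sAS-> ->]. Qed.

Lemma supportedB S m c e : supported S m c -> supported S m e -> supported S m (c - e).
Proof.
move=> cS eS F; rewrite !ffunE => ce0; case: (eqVneq (c F) 0) => [cF0|/cS//].
by apply: eS; apply: contraNneq ce0 => ->; rewrite cF0 subr0.
Qed.

Lemma supportedD S m c e : supported S m c -> supported S m e -> supported S m (c + e).
Proof.
move=> cS eS F; rewrite !ffunE => ce0; case: (eqVneq (c F) 0) => [cF0|/cS//].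
by apply: eS; apply: contraNneq ce0 => ->; rewrite cF0 addr0.
Qed.

Lemma boundary_coface c G : boundary c G != 0 ->
  exists2 v, v \notin G & c (v |: G) != 0.
Proof.
move=> cG; apply/exists_inP; apply: contraNT cG => /exists_inPn cG0.
rewrite boundaryE big1 // => v vG; have /negPn/eqP-> := cG0 v vG; exact: mulr0.
Qed.

Lemma supported_boundary S A m c : supported S m c ->
  supported A m.-1 (restriction A (boundary c)).
Proof.
move=> cS G; rewrite ffunE; case: ifP => [GA|]; last by rewrite eqxx.
move=> /boundary_coface[v vG /cS/andP[_]]; rewrite cardsU1 vG => /eqP<-.
by rewrite add1n eqxx.
Qed.

Lemma restriction_boundary_boundary S m c G : convex_family S -> supported S m c ->
  G \in S -> boundary (restriction S (boundary c)) G = 0.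
Proof.
move=> convS cS GS; rewrite -(boundary_boundary c G) !boundaryE.
apply: eq_bigr => v vG; rewrite ffunE; case: ifPn => // vGS; congr (_ * _).
apply/esym/eqP; apply: contraNT vGS => /boundary_coface[u uG /cS/andP[uS _]].
exact: convS GS uS (subsetUr _ _) (subsetUr _ _).
Qed.

Lemma boundaryB c e G : boundary (c - e) G = boundary c G - boundary e G.
Proof. by rewrite linearB !ffunE. Qed.

Lemma boundaryD c e G : boundary (c + e) G = boundary c G + boundary e G.
Proof. by rewrite linearD !ffunE. Qed.

Lemma boundary_restriction A S m c G : ideal_of A S -> supported S m c ->
  G \in S -> G \notin A -> boundary (restriction (S :\: A) c) G = boundary c G.
Proof.
move=> [sAS downA] cS GS GA; rewrite !boundaryE; apply: eq_bigr => v vG.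
congr (_ * _); rewrite ffunE; case: ifPn => //; rewrite inE negb_and negbK.
case/orP => [vA|vS]; last by rewrite (supported0 cS).
by rewrite (downA _ _ vA GS (subsetUr _ _)) in GA.
Qed.

(** Exactness at the middle of the sequence of [A], [S] and [S :\: A]: fill [c] outside [A], then
    fill the remaining error, which is a cycle in [A]. *)
Lemma acyclic_at_union A S m : convex_family S -> ideal_of A S ->
  acyclic_at A m -> acyclic_at (S :\: A) m -> acyclic_at S m.
Proof.
move=> convS idA acA acB c cS bc0.
have [sAS downA] := idA.
have sBS : {subset S :\: A <= S} by move=> F; rewrite inE => /andP[].
have [G|e1 e1B be1] := acB _ (supported_restriction (A := S :\: A) cS).
  by rewrite inE => /andP[GA GS]; rewrite (boundary_restriction idA cS) ?bc0.
have e1S := supported_sub sBS e1B.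
pose c1 := c - restriction S (boundary e1).
have c1A : supported A m c1.
  have c1S : supported S m c1 by apply: supportedB => //; exact: (supported_boundary (A := S) e1S).
  move=> F c1F; have /andP[FS ->] := c1S F c1F; rewrite andbT.
  apply: contraNT c1F => FA; rewrite !ffunE FS be1 ?inE ?FA ?ffunE ?inE ?FA ?FS //=.
  by rewrite subrr.
have [G GA|e2 e2A be2] := acA _ c1A.
  have GS := sAS _ GA.
  by rewrite boundaryB bc0 // (restriction_boundary_boundary convS e1S) ?subr0.
exists (e1 + e2); first by apply: supportedD => //; exact: supported_sub e2A.
move=> G GS; rewrite boundaryD; case: (boolP (G \in A)) => GA.
  by rewrite be2 // !ffunE GS addrC subrK.
rewrite be1 ?inE ?GA // ffunE inE GA GS /= (_ : boundary e2 G = 0) ?addr0 //.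
apply/eqP; apply: contraNT GA => /boundary_coface[v vG /e2A/andP[vA _]].
exact: downA vA GS (subsetUr _ _).
Qed.

(** The boundary of a relative cycle is a cycle in [A] one degree lower; filling it there corrects
    [c] to a cycle of [S]. *)
Lemma acyclic_at_quotient A S m : convex_family S -> ideal_of A S ->
  acyclic_at S m -> acyclic_at A m.-1 -> acyclic_at (S :\: A) m.
Proof.
move=> convS idA acS acA c cB bc0.
have [sAS downA] := idA.
have sBS : {subset S :\: A <= S} by move=> F; rewrite inE => /andP[].
have cS := supported_sub sBS cB.
have [e1 e1A be1] : exists2 e, supported A m e &
    forall G, G \in A -> boundary e G = boundary c G.
  (* In degree 0 the predecessor is again 0; here the boundary of [c] vanishes because every coface
     is nonempty. *)
  case: m => [|m] in cS cB acA acS *.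
    exists 0 => [F|G GA]; first by rewrite ffunE eqxx.
    rewrite linear0 ffunE; apply/esym/eqP; apply/negPn/negP.
    by case/boundary_coface=> v vG /cS/andP[_]; rewrite cardsU1 vG.
  have [G GA|e eA be] := acA _ (supported_boundary (A := A) cS).
    rewrite -(restriction_boundary_boundary convS cS (sAS _ GA)) !boundaryE.
    apply: eq_bigr => v vG; congr (_ * _); rewrite !ffunE.
    case: (boolP (_ \in A)) => [/sAS->//|vA]; case: ifP => // vS.
    by rewrite bc0 // inE vA.
  by exists e => // G GA; rewrite be // ffunE GA.
have [||e2 e2S be2] := acS (c - e1).
- by apply: supportedB => //; exact: supported_sub e1A.
- move=> G GS; rewrite boundaryB; case: (boolP (G \in A)) => [/be1->|GA].
    exact: subrr.
  rewrite bc0 ?inE ?GA // (_ : boundary e1 G = 0) ?subr0 //.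
  apply/eqP; apply: contraNT GA => /boundary_coface[v vG /e1A/andP[vA _]].
  exact: downA vA GS (subsetUr _ _).
exists (restriction (S :\: A) e2); first exact: supported_restriction e2S.
move=> G; rewrite inE => /andP[GA GS].
rewrite (boundary_restriction idA e2S) // be2 // !ffunE.
by rewrite (supported0 e1A GA) subr0.
Qed.

(** A filling of [c] in [S] restricts to a relative cycle of [S :\: A]; subtracting the boundary of
    a filling of that cycle moves it into [A]. *)
Lemma acyclic_at_ideal A S m : convex_family S -> ideal_of A S ->
  acyclic_at S m -> acyclic_at (S :\: A) m.+1 -> acyclic_at A m.
Proof.
move=> convS idA acS acB c cA bc0.
have [sAS downA] := idA.
have sBS : {subset S :\: A <= S} by move=> F; rewrite inE => /andP[].
have cS := supported_sub sAS cA.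
have [G GS|e1 e1S be1] := acS c cS.
  case: (boolP (G \in A)) => [/bc0//|GA].
  apply/eqP; apply: contraNT GA => /boundary_coface[v vG /cA/andP[vA _]].
  exact: downA vA GS (subsetUr _ _).
have [|e2 e2B be2] := acB _ (supported_restriction (A := S :\: A) e1S).
  move=> G; rewrite inE => /andP[GA GS].
  by rewrite (boundary_restriction idA e1S) // be1 // (supported0 cA GA).
have e2S := supported_sub sBS e2B.
pose e := e1 - restriction S (boundary e2).
exists e.
  have eS : supported S m.+1 e.
    by apply: supportedB => //; exact: (supported_boundary (A := S) e2S).
  move=> F eF; have /andP[FS ->] := eS F eF; rewrite andbT.
  apply: contraNT eF => FA; rewrite !ffunE FS be2 ?inE ?FA //.
  by rewrite ffunE inE FA FS subrr.
move=> G GA; have GS := sAS _ GA.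
by rewrite boundaryB (restriction_boundary_boundary convS e2S) // subr0 be1.
Qed.

Lemma acyclic_at_shift S v m : (forall F, F \in S -> v \in F) ->
  acyclic_at [set F : {set 'I_n} | (v \notin F) && (v |: F \in S)] m -> acyclic_at S m.+1.
Proof.
move=> vS; set S' := [set F | _] => acS' c cS bc0.
(* The insertion sign makes deletion of [v] anticommute with the boundary; the minus sign in [add]
   below compensates for this. *)
pose del (c : chain K n) : chain K n :=
  [ffun F : {set 'I_n} => if v \in F then 0 else insertion_sign F v * c (v |: F)].
have bdel d G : v \notin G ->
    boundary (del d) G = - (insertion_sign G v * boundary d (v |: G)).
  move=> vG; rewrite !boundaryE (bigD1 v) //= ffunE setU11 mulr0 add0r.
  rewrite mulr_sumr -sumrN; apply: eq_big => [u|u /andP[uG uv]].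
    by rewrite !inE negb_or andbC.
  rewrite ffunE !inE (negPf vG) eq_sym (negPf uv) /= setUCA !mulrA.
  by rewrite (insertion_sign_swap (v := u) (u := v)) 1?eq_sym // mulNr.
pose add (c : chain K n) : chain K n :=
  [ffun F : {set 'I_n} => if v \in F then - (insertion_sign (F :\ v) v * c (F :\ v)) else 0].
have [||e eS' be] := acS' (del c).
- move=> F; rewrite ffunE; case: ifP => [|vF]; first by rewrite eqxx.
  rewrite mulf_eq0 => /norP[_ /cS/andP[FS]]; rewrite cardsU1 vF inE FS vF.
  by rewrite eqSS.
- move=> G; rewrite inE => /andP[vG GS]; rewrite bdel // bc0 // mulr0 oppr0 //.
have deladd : del (add e) = - e.
  apply/ffunP => F; rewrite !ffunE setU11; case: ifP => vF.
    by rewrite (supported0 eS') ?oppr0 // inE vF.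
  by rewrite setU1K ?vF // mulrN mulrA insertion_sign_sq mul1r.
exists (add e).
  move=> F; rewrite ffunE; case: ifP => [vF|]; last by rewrite eqxx.
  rewrite oppr_eq0 mulf_eq0 => /norP[_ /eS']; rewrite inE setD1K // [#|F|](cardsD1 v).
  by rewrite vF eqSS => /andP[/andP[_ ->] ->].
move=> G GS; have vG := vS G GS; have GvS' : G :\ v \in S' by rewrite inE !inE eqxx setD1K.
have eq : insertion_sign (G :\ v) v * boundary (add e) G =
    insertion_sign (G :\ v) v * c G.
  have vGv : v \notin G :\ v by rewrite !inE eqxx.
  have := bdel (add e) _ vGv; rewrite setD1K // deladd linearN ffunE => /oppr_inj <-.
  by rewrite be // ffunE (negPf vGv) setD1K.
have := congr1 (fun x => insertion_sign (G :\ v) v * x) eq.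
by rewrite !mulrA insertion_sign_sq !mul1r.
Qed.

(** Coning with apex [v] is a contracting homotopy. *)
Lemma acyclic_at_cone S v m :
  (forall F, v \notin F -> (v |: F \in S) = (F \in S)) -> acyclic_at S m.
Proof.
move=> coneS c cS bc0.
pose e : chain K n :=
  [ffun F : {set 'I_n} => if v \in F then insertion_sign (F :\ v) v * c (F :\ v) else 0].
exists e.
  move=> F; rewrite ffunE; case: ifP => [vF|]; last by rewrite eqxx.
  rewrite mulf_eq0 => /norP[_ /cS]; rewrite -coneS ?inE ?eqxx // setD1K //.
  by rewrite [#|F|](cardsD1 v) vF eqSS.
move=> G GS; rewrite boundaryE; case: (boolP (v \in G)) => vG; last first.
  rewrite (bigD1 v) //= ffunE setU11 setU1K // mulrA insertion_sign_sq mul1r.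
  rewrite big1 ?addr0 // => u /andP[uG uv]; rewrite ffunE !inE eq_sym (negPf uv).
  by rewrite (negPf vG) mulr0.
have vH : v \notin G :\ v by rewrite !inE eqxx.
have HS : G :\ v \in S by rewrite -coneS // setD1K.
(* For [G] containing [v], the cycle condition at [G :\ v] expresses [c G] through the other
   cofaces, and these give the boundary of [e] at [G]. *)
have := bc0 _ HS; rewrite boundaryE (bigD1 v) //= setD1K // => /eqP.
rewrite addr_eq0 => /eqP bH.
transitivity (insertion_sign (G :\ v) v * (insertion_sign (G :\ v) v * c G)); last first.
  by rewrite mulrA insertion_sign_sq mul1r.
rewrite bH mulrN mulr_sumr -sumrN; apply: eq_big => [u|u uG].
  by rewrite !inE negb_and negbK; case: eqP => [->|]; rewrite ?vG ?andbT ?andbF.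
have uv : u != v by apply: contraNneq uG => ->.
have uH : u \notin G :\ v by rewrite !inE (negPf uG) andbF.
have UH : (u |: G) :\ v = u |: G :\ v.
  by apply/setP => w; rewrite !inE; case: (eqVneq w v) => [->|//]; rewrite eq_sym (negPf uv).
rewrite ffunE !inE vG orbT UH.
have sw := insertion_sign_swap uv uH vH; rewrite setD1K // in sw.
rewrite !mulrA -mulNr; congr (_ * _).
have := congr1 (fun x => insertion_sign (G :\ v) v * x * insertion_sign (u |: G :\ v) v) sw.
rewrite !mulrA insertion_sign_sq mul1r mulrN mulNr => ->; congr (- _).
by rewrite mulrA -mulrA insertion_sign_sq mulr1.
Qed.

End Chains.

(** * Packings of blocks *)

Section Packings.
Variables (n t : nat).
Hypothesis t_gt0 : (0 < t)%N.
Implicit Types (F G H A : {set 'I_n}) (a s k m : nat).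

Definition block_in a G :=
  (a + t <= n)%N && [forall j : 'I_n, (a <= j < a + t)%N ==> (j \in G)].

(** Blocks are chosen from left to right, so disjointness only compares each block with the previous
    one and greedy arguments become inductions. *)
Fixpoint packs k s G : bool :=
  if k is k'.+1 then
    [exists a : 'I_n, [&& (s <= a)%N, block_in a G & packs k' (a + t) G]]
  else true.

Lemma block_inP a G :
  reflect ((a + t <= n)%N /\ forall j : 'I_n, (a <= j < a + t)%N -> j \in G)
          (block_in a G).
Proof.
apply: (iffP andP) => -[le_n blk]; split=> //.
  by move=> j; apply/implyP; exact: (forallP blk).
by apply/forallP => j; apply/implyP/blk.
Qed.

Lemma packsP k s G :
  reflect (exists a : nat, [/\ (s <= a)%N, block_in a G & packs k (a + t) G])
          (packs k.+1 s G).
Proof.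
apply: (iffP existsP) => [[a /and3P[? ? ?]]|[a [sa blk pk]]]; first by exists a.
have lt_an : (a < n)%N by case/andP: blk => le_n _; lia.
by exists (Ordinal lt_an); rewrite /= sa blk.
Qed.

Lemma sub_packs k s G H : (forall j : 'I_n, (s <= j)%N -> j \in G -> j \in H) ->
  packs k s G -> packs k s H.
Proof.
elim: k s => [//|k IHk] s sGH /packsP[a [sa /block_inP[le_n blk] pk]].
apply/packsP; exists a; split=> //; last by apply: IHk pk => j ?; apply: sGH; lia.
by apply/block_inP; split=> // j aj; apply: sGH (blk j aj); lia.
Qed.

Lemma eq_packs k s G H : (forall j : 'I_n, (s <= j)%N -> (j \in G) = (j \in H)) ->
  packs k s G = packs k s H.
Proof. by move=> GH; apply/idP/idP; apply: sub_packs => j /GH->. Qed.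

Lemma packs_start k s s' G : (s' <= s)%N -> packs k s G -> packs k s' G.
Proof.
case: k => [//|k] ss' /packsP[a [sa blk pk]]; apply/packsP; exists a; split=> //; lia.
Qed.

Lemma packs_pred k s G : packs k.+1 s G -> packs k s G.
Proof. by case/packsP=> a [sa _]; apply: packs_start; lia. Qed.

(** Greedy choice: the first block of any packing starts at [s] or later, so the block at [s] can
    replace it. *)
Lemma packs_block k s G : block_in s G -> packs k.+1 s G = packs k (s + t) G.
Proof.
move=> blk; apply/packsP/idP => [[a [sa _]]|pk]; last by exists s.
by apply: packs_start; lia.
Qed.

Lemma packs_noblock k s G : ~~ block_in s G -> packs k.+1 s G -> packs k.+1 s.+1 G.
Proof.
move=> nblk /packsP[a [sa blk pk]]; apply/packsP; exists a; split=> //.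
rewrite ltn_neqAle sa andbT; apply: contraNneq nblk => -> //.
Qed.

(** A block starting between [s] and [u] would contain the missing point [u], since [u < s + t]. *)
Lemma packs_skip k s u G : (s <= u < s + t)%N ->
  (forall j : 'I_n, j = u :> nat -> j \notin G) -> packs k s G = packs k u.+1 G.
Proof.
case: k => [//|k] su uG; apply/idP/idP; last by apply: packs_start; lia.
case/packsP=> a [sa /block_inP[le_n blk] pk]; apply/packsP; exists a; split=> //.
  rewrite ltnNge; apply/negP => au; have lt_un : (u < n)%N by lia.
  by have /negP[] := uG (Ordinal lt_un) erefl; apply: blk => /=; lia.
by apply/block_inP.
Qed.

Lemma packs_bound k s G : packs k.+1 s G -> (s + k.+1 * t <= n)%N.
Proof.
elim: k s => [|k IHk] s /packsP[a [sa /andP[le_n _]]] => [_|/IHk]; lia.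
Qed.

Definition from s A := [set x in A | (s <= x)%N].

(** For [s = 0] these are the links in the dual complex; larger [s] arise as the recursion moves
    along the path. *)
Definition pack_complex s A k : {set {set 'I_n}} :=
  [set F : {set 'I_n} | (F \subset from s A) && packs k s (A :\: F)].

(* The faces of [pack_complex s A k] left over after pairing [F] with [s |: F]. *)
Definition pack_core s A k : {set {set 'I_n}} :=
  [set F : {set 'I_n} | [&& F \subset from s.+1 A, packs k s (A :\: F)
                          & ~~ packs k s.+1 (A :\: F)]].

Lemma packsDS k s A F G : F \subset G -> packs k s (A :\: G) -> packs k s (A :\: F).
Proof.
move=> FG; apply: sub_packs => j _; rewrite !inE => /andP[jG ->].
by rewrite andbT; apply: contra jG; apply: (subsetP FG).
Qed.

Lemma from_sub s s' A : (s <= s')%N -> from s' A \subset from s A.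
Proof. by move=> ss'; apply/subsetP => j; rewrite !inE => /andP[->]; lia. Qed.

Lemma pack_complex_convex s A k : convex_family (pack_complex s A k).
Proof.
move=> F G H _; rewrite !inE => /andP[HA pk] _ GH.
by rewrite (subset_trans GH HA) (packsDS GH pk).
Qed.

Lemma pack_core_convex s A k : convex_family (pack_core s A k).
Proof.
move=> F G H; rewrite !inE => /and3P[_ _ npk] /and3P[HA pk _] FG GH.
rewrite (subset_trans GH HA) (packsDS GH pk); apply: contra npk; exact: packsDS.
Qed.

Lemma pack_complex_succ s A k : (forall j : 'I_n, j = s :> nat -> j \notin A) ->
  pack_complex s A k = pack_complex s.+1 A k.
Proof.
move=> sA; have sE : from s A = from s.+1 A.
  apply/setP => j; rewrite !inE; case: (boolP (j \in A)) => //= jA.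
  rewrite [RHS]ltn_neqAle; case: eqP => // js.
  by rewrite (negPf (sA j (esym js))) in jA.
apply/setP => F; rewrite !inE sE; congr (_ && _).
by apply: packs_skip; [lia|move=> j /sA jA; rewrite !inE (negPf jA) andbF].
Qed.

(** A packing that is lost when it must start after [s] uses the block at [s], so [F] avoids that
    block. *)
Lemma mem_pack_core s A k F : block_in s A ->
  (F \in pack_core s A k.+1) =
  [&& F \subset from (s + t) A, packs k (s + t) (A :\: F) & ~~ packs k.+1 s.+1 (A :\: F)].
Proof.
move=> /block_inP[le_n blkA]; rewrite inE; apply/and3P/and3P => -[FA pk npk].
  have blk : block_in s (A :\: F).
    by apply: contraNT npk => /packs_noblock; apply.
  rewrite -packs_block // pk npk; split=> //.
  apply/subsetP => j jF; have := subsetP FA j jF; rewrite !inE => /andP[jA sj].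
  rewrite jA leqNgt; apply/negP => ju; case/block_inP: blk => _ /(_ j).
  by rewrite inE jF => /(_ ltac:(lia)).
have blk : block_in s (A :\: F).
  apply/block_inP; split=> // j sj; rewrite inE blkA // andbT.
  by apply/negP => /(subsetP FA); rewrite inE; lia.
split=> //; last by rewrite packs_block.
by apply: subset_trans FA (from_sub _ _); lia.
Qed.

Lemma pack_core_noblock s A k : ~~ block_in s A -> pack_core s A k = set0.
Proof.
move=> nblk; apply/setP => F; rewrite !inE; apply/and3P => -[_ pk /negP[]].
case: k pk => [//|k]; apply: packs_noblock; apply: contra nblk.
move=> /block_inP[le_n blk]; apply/block_inP; split=> // j /blk.
by rewrite inE => /andP[].
Qed.

(** No block contains [s + t], so both packing conditions restart just after it. *)
Lemma pack_core_gap s A k : block_in s A ->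
  (forall j : 'I_n, j = (s + t)%N :> nat -> j \notin A) ->
  pack_core s A k.+1 =
  pack_complex (s + t).+1 A k :\: pack_complex (s + t).+1 A k.+1.
Proof.
move=> blk uA; apply/setP => F; rewrite mem_pack_core // [RHS]inE !(inE, in_set).
have -> : from (s + t) A = from (s + t).+1 A.
  apply/setP => j; rewrite !inE; case: (boolP (j \in A)) => //= jA.
  rewrite [RHS]ltn_neqAle; case: eqP => // ju.
  by rewrite (negPf (uA j (esym ju))) in jA.
have uG (j : 'I_n) : j = (s + t)%N :> nat -> j \notin A :\: F.
  by move=> /uA jA; rewrite inE (negPf jA) andbF.
rewrite (packs_skip _ (s := s + t) (u := s + t)) //; last lia.
rewrite (packs_skip _ (s := s.+1) (u := s + t)) //; last lia.
by case: (_ \subset _) => //=; rewrite andbC.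
Qed.

(** When [F] avoids [u], the points from [s + 1] to [u] form a block too; taking it first turns the
    forbidden [k + 1] blocks from [s + 1] into [k] blocks from [u + 1]. *)
Lemma pack_core_avoid s A k (u : 'I_n) : block_in s A -> u = (s + t)%N :> nat ->
  u \in A -> [set F in pack_core s A k.+1 | u \notin F] = pack_core u A k.
Proof.
move=> blk us uA; apply/setP => F; rewrite inE mem_pack_core // -us [RHS]inE.
apply/andP/and3P => [[/and3P[FA pk npk] uF]|[FA pk npk]].
  have FA1 : F \subset from u.+1 A.
    apply/subsetP => j jF; have := subsetP FA j jF; rewrite !inE => /andP[-> uj].
    by rewrite ltn_neqAle uj andbT; apply: contraNneq uF => /val_inj->.
  split=> //; rewrite us -addSn -packs_block //; apply/block_inP; split.
    by rewrite addSn -us.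
  move=> j sj; rewrite inE; apply/andP; split.
    by apply/negP => /(subsetP FA1); rewrite inE us; lia.
  case: (ltnP j u) => ju; last by rewrite (_ : j = u) //; apply: val_inj => /=; lia.
  by case/block_inP: blk => _; apply; lia.
have uF : u \notin F by apply/negP => /(subsetP FA); rewrite inE ltnn andbF.
split=> //; rewrite pk (subset_trans FA (from_sub _ (leqnSn u))) !andTb.
rewrite packs_block ?addSn -?us //; apply/block_inP; split.
  by rewrite addSn -us.
move=> j sj; rewrite inE; apply/andP; split.
  by apply/negP => /(subsetP FA); rewrite inE us; lia.
case: (ltnP j u) => ju; last by rewrite (_ : j = u) //; apply: val_inj => /=; lia.
by case/block_inP: blk => _; apply; lia.
Qed.

(** A face containing [u] leaves a gap at [s + t], as in [pack_core_gap]; deleting [u] gives the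
    form needed for [acyclic_at_shift]. *)
Lemma pack_core_meet s A k (u : 'I_n) : block_in s A -> u = (s + t)%N :> nat ->
  u \in A ->
  [set F : {set 'I_n} | (u \notin F) && (u |: F \in pack_core s A k.+1)] =
  pack_complex u.+1 A k :\: pack_complex u.+1 A k.+1.
Proof.
move=> blk us uA; apply/setP => F; rewrite inE mem_pack_core // -us [RHS]inE !inE.
have uG (j : 'I_n) : j = u :> nat -> j \notin A :\: (u |: F).
  by move=> /val_inj->; rewrite !inE eqxx.
rewrite (packs_skip _ (s := u) (u := u)) //; last lia.
rewrite (packs_skip _ (s := s.+1) (u := u)) //; last lia.
have eqp k' : packs k' u.+1 (A :\: (u |: F)) = packs k' u.+1 (A :\: F).
  apply: eq_packs => j uj; rewrite !inE; case: eqP => // ju.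
  by rewrite ju ltnn in uj.
rewrite !eqp.
have -> : (u \notin F) && [&& u |: F \subset from u A, packs k u.+1 (A :\: F)
            & ~~ packs k.+1 u.+1 (A :\: F)] =
   [&& F \subset from u.+1 A, packs k u.+1 (A :\: F) & ~~ packs k.+1 u.+1 (A :\: F)].
  rewrite andbA; congr (_ && _); apply/andP/idP => [[uF FA]|FA].
    apply/subsetP => j jF; have := subsetP FA j; rewrite !inE jF orbT.
    move=> /(_ isT)/andP[-> uj].
    by rewrite ltn_neqAle uj andbT; apply: contraNneq uF => /val_inj->.
  split; first by apply/negP => /(subsetP FA); rewrite inE ltnn andbF.
  apply/subsetP => j; rewrite !inE => /orP[/eqP->|]; first by rewrite uA leqnn.
  by move/(subsetP FA); rewrite inE => /andP[->]; exact: ltnW.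
by case: (_ \subset _) => //=; rewrite andbC.
Qed.

End Packings.

(** * The upper bound *)

Definition leray_step t x : nat := (x %/ t.+1 + x.+1 %/ t.+1)%N.

(** [y] is the slack left by [k] blocks. Using up one block together with one extra point raises the
    dimension by 1, hence the first [k] units; skipping [t + 1] points with [k] unchanged raises it
    by 2, hence the growth of [leray_step]. *)
Definition leray_bound t l k : nat :=
  let y := (l - k * t)%N in
  (if y <= k then y else k + leray_step t (y - k))%N.

Lemma leray_step_period t x : leray_step t (x + t.+1) = (leray_step t x + 2)%N.
Proof.
by rewrite /leray_step -addSn !divnDr ?dvdnn // divnn /=; lia.
Qed.

Lemma leray_step_le t x : (leray_step t x <= leray_step t x.+1)%N.
Proof. by rewrite /leray_step leq_add // leq_div2r. Qed.

Lemma leray_step_lt t x : (0 < t)%N -> (leray_step t x.+1 <= (leray_step t x).+1)%N.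
Proof.
move=> t_gt0; rewrite /leray_step.
have : (x.+2 %/ t.+1 <= (x + t.+1) %/ t.+1)%N by apply: leq_div2r; lia.
rewrite divnDr // divnn addn1; move: (x %/ _)%N (x.+1 %/ _)%N (x.+2 %/ _)%N => a b c.
by lia.
Qed.

Lemma leray_step_small t x : (x <= t.+1)%N -> (x.+1 <= leray_step t x + t)%N.
Proof.
move=> xt; rewrite /leray_step; set a := (x %/ _)%N; set b := (x.+1 %/ _)%N.
case: (ltngtP x t) => xt'; first lia.
  have a_gt0 : (0 < a)%N by rewrite /a divn_gt0.
  have b_gt0 : (0 < b)%N by rewrite /b divn_gt0 // ltnW.
  lia.
have b_gt0 : (0 < b)%N by rewrite /b divn_gt0 // xt'.
lia.
Qed.

Section LerayBound.
Variables (t l k : nat).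
Hypothesis t_gt0 : (0 < t)%N.

(** This lemma and the next three match the moves of the recursion: skipping a point outside [A],
    passing to the core one block further on, and the dimension shifts by 1 and by 2. *)
Lemma leray_bound_skip : (leray_bound t l.-1 k <= leray_bound t l k)%N.
Proof.
rewrite /leray_bound; set y := (l.-1 - k * t)%N; set y' := (l - k * t)%N.
have [->//|->] : y' = y \/ y' = y.+1 by rewrite /y /y'; lia.
have [yk|yk] := leqP y k; have [yk'|yk'] := ltnP y k; try lia.
by rewrite subSn ?leq_add2l ?leray_step_le // ltnW.
Qed.

Lemma leray_bound_block : (leray_bound t (l - t) k <= leray_bound t l k.+1)%N.
Proof.
rewrite /leray_bound mulSn subnDA; set y := (l - t - k * t)%N.
have [yk|yk] := leqP y k; have [yk1|yk1] := leqP y k.+1; try lia.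
  rewrite (_ : y = k.+1); last lia.
  rewrite subSnn; have := leray_step_lt 0 t_gt0.
  by rewrite {2}/leray_step div0n divn_small //; lia.
rewrite (_ : (y - k = (y - k.+1).+1)%N); last lia.
by have := leray_step_lt (y - k.+1) t_gt0; lia.
Qed.

Lemma leray_bound_meet : (k.+1 * t < l)%N ->
  (leray_bound t (l - t.+1) k < leray_bound t l k.+1)%N.
Proof.
move=> lkt; rewrite /leray_bound (_ : (l - t.+1 - k * t = (l - k.+1 * t).-1)%N); last lia.
set y := (l - _)%N; have y_gt0 : (0 < y)%N by rewrite /y; lia.
have [yk|yk] := leqP y.-1 k; have [yk1|yk1] := leqP y k.+1; try lia.
by rewrite (_ : (y.-1 - k = y - k.+1)%N); lia.
Qed.

Lemma leray_bound_loop : (k * t <= l - t.+1)%N -> (t < l)%N ->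
  (leray_bound t (l - t.+1) k + 2 <= leray_bound t l k)%N.
Proof.
move=> lkt lt; rewrite /leray_bound.
rewrite (_ : (l - t.+1 - k * t = l - k * t - t.+1)%N); last lia.
set y := (l - k * t)%N; have y_t : (t < y)%N by rewrite /y; lia.
have [yk|yk] := leqP y k; have [ytk|ytk] := leqP (y - t.+1)%N k; try lia.
  by have := @leray_step_small t (y - k); lia.
rewrite [(y - k)%N](_ : _ = y - t.+1 - k + t.+1)%N; last lia.
by rewrite leray_step_period; lia.
Qed.

End LerayBound.

(** * Acyclicity of the packing complexes above the bound *)

Section UpperBound.
Variables (K : fieldType) (n t : nat).
Hypothesis t_gt0 : (0 < t)%N.
Implicit Types (F G H A : {set 'I_n}) (s k m l : nat).

Lemma acyclic_at_nocard (S : {set {set 'I_n}}) m :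
  (forall F, F \in S -> #|F| <> m) -> acyclic_at K S m.
Proof.
move=> cardS c cS _; exists 0 => [F|G _]; first by rewrite ffunE eqxx.
rewrite linear0 ffunE; apply/esym/eqP; apply/negPn/negP.
by move=> /cS/andP[/cardS cG /eqP].
Qed.

(** The faces that remain faces after adding [v] form a cone with apex [v], hence an acyclic
    subcomplex; the quotient is the core. *)
Lemma pack_complex_core s A k m (v : 'I_n) : v = s :> nat -> v \in A ->
  acyclic_at K (pack_core t s A k) m -> acyclic_at K (pack_complex t s A k) m.
Proof.
move=> vs vA acN.
pose S := pack_complex t s A k.
pose C := [set F in S | v |: F \in S].
have memC F : (F \in C) = (F \in S) && (v |: F \in S) by rewrite [LHS]inE.
have downS F G : F \in S -> G \subset F -> G \in S.
  rewrite !inE => /andP[FA pk] GF.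
  by rewrite (subset_trans GF FA) (packsDS t_gt0 GF pk).
have idC : ideal_of C S.
  split=> [F|F G]; rewrite !memC; first by case/andP.
  move=> /andP[_ vF] -> GF.
  by apply: downS vF _; apply: setUS.
apply: (acyclic_at_union _ idC); first exact: pack_complex_convex.
  apply: (@acyclic_at_cone _ _ _ v) => F vF; rewrite !memC.
  rewrite setUA setUid andbb andbC; case: (boolP (v |: F \in S)) => //= vFS.
  by rewrite (downS _ _ vFS (subsetUr _ _)).
rewrite (_ : S :\: C = pack_core t s A k) //.
have vfrom : v \in from s A by rewrite inE vA vs leqnn.
have skip F : packs t k s (A :\: (v |: F)) = packs t k s.+1 (A :\: F).
  have ss : (s <= s < s + t)%N by lia.
  rewrite (packs_skip t_gt0 _ ss); last first.
    by move=> j; rewrite -vs => /val_inj->; rewrite !inE eqxx.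
  apply: (eq_packs t_gt0) => j sj; rewrite !inE; case: eqP => // jv.
  by rewrite jv vs ltnn in sj.
apply/setP => F; rewrite inE memC !inE skip subUset sub1set vfrom /=.
case: (boolP (v \in F)) => vF.
  have -> : F \subset from s.+1 A = false.
    by apply/negP => /subsetP/(_ v vF); rewrite inE vs ltnn andbF.
  rewrite /= -skip (setUidPr _) ?sub1set //.
  by case: (F \subset _) => //=; case: (packs _ _ _ _).
have -> : F \subset from s.+1 A = (F \subset from s A).
  apply/idP/idP => FA; first exact: subset_trans FA (from_sub t_gt0 _ (leqnSn s)).
  apply/subsetP => j jF; have := subsetP FA j jF; rewrite !inE => /andP[-> sj] /=.
  by rewrite ltn_neqAle sj andbT -vs; apply: contraNneq vF => /val_inj->.
by case: (_ \subset _) => //=; case: (packs _ _ s _) => //=; rewrite ?andbT ?andbF.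
Qed.

Lemma acyclic_pack_diff s A k m : acyclic_at K (pack_complex t s A k) m ->
  acyclic_at K (pack_complex t s A k.+1) m.-1 ->
  acyclic_at K (pack_complex t s A k :\: pack_complex t s A k.+1) m.
Proof.
apply: acyclic_at_quotient; first exact: pack_complex_convex.
split=> [F|F G]; rewrite !(inE, in_set) => /andP[FA pk].
  by rewrite FA (packs_pred t_gt0 pk).
by move=> /andP[-> _] GF; rewrite (packsDS t_gt0 GF pk).
Qed.

(** With fewer than [k * t] points the family is empty and acyclic in every degree, whereas
    truncated subtraction makes [leray_bound] equal to 0. *)
Definition above_bound l k m := (l < k * t)%N || (leray_bound t l k < m)%N.

Lemma acyclic_pack_complex_end s A k m : (n <= s)%N -> above_bound (n - s) k m ->
  acyclic_at K (pack_complex t s A k) m.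
Proof.
move=> ns ab; apply: acyclic_at_nocard => F; rewrite inE => /andP[FA].
case: k ab => [|k] ab; last by move=> /(packs_bound t_gt0); lia.
have -> : F = set0.
  apply/eqP; rewrite -subset0; apply: subset_trans FA _; apply/subsetP => j.
  by rewrite inE; have := ltn_ord j; lia.
by rewrite cards0; move: ab; rewrite /above_bound; case: m; lia.
Qed.

Lemma acyclic_pack_core s A k m : (s < n)%N ->
  (forall s', (s < s')%N -> forall (u : 'I_n) k m, u = s' :> nat -> u \in A ->
     above_bound (n - s') k m -> acyclic_at K (pack_core t s' A k) m) ->
  (forall s', (s < s')%N -> forall k m,
     above_bound (n - s') k m -> acyclic_at K (pack_complex t s' A k) m) ->
  above_bound (n - s) k m -> acyclic_at K (pack_core t s A k) m.
Proof.
move=> sn IHcore IHcpx.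
have empty (S : {set {set 'I_n}}) m' : S = set0 -> acyclic_at K S m'.
  by move=> ->; apply: acyclic_at_nocard => F; rewrite inE.
case: k => [|k] ab; first by apply: empty; apply/setP => F; rewrite !inE !andbF.
case: (boolP (block_in t s A)) => [blk|]; last first.
  by move=> nblk; apply: empty; apply: pack_core_noblock.
have le_n : (s + t <= n)%N by case/andP: blk.
case: (leqP (k.+1 * t) (n - s)) => [|lkt]; last first.
  apply: acyclic_at_nocard => F; rewrite inE => /and3P[_].
  by move=> /(packs_bound t_gt0); lia.
move=> lkt; have {}ab : (leray_bound t (n - s) k.+1 < m)%N.
  by move: ab; rewrite /above_bound ltnNge lkt.
have nst : (n - (s + t).+1 = n - s - t.+1)%N by lia.
have ab_meet : (s + t < n)%N -> above_bound (n - (s + t).+1) k m.-1.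
  move=> stn; rewrite /above_bound nst.
  case: ltnP => //= lk; have := @leray_bound_meet t (n - s) k t_gt0.
  by move/(_ ltac:(lia)); lia.
have ab_meet' : above_bound (n - (s + t).+1) k m.
  rewrite /above_bound nst; case: ltnP => //= lk.
  case: (ltnP (k.+1 * t) (n - s)) => lkt'.
    by have := @leray_bound_meet t (n - s) k t_gt0 lkt'; lia.
  (* Here [n - s] equals [k.+1 * t], so truncated subtraction leaves slack 0 and the bound is 0. *)
  by rewrite /leray_bound (_ : n - s - t.+1 - k * t = 0)%N /=; lia.
have ab_loop : above_bound (n - (s + t).+1) k.+1 m.-1.-1.
  rewrite /above_bound nst; case: ltnP => //= lk.
  by have := @leray_bound_loop t (n - s) k.+1 t_gt0 lk; lia.
have ab_loop' : above_bound (n - (s + t).+1) k.+1 m.-1.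
  by move: ab_loop; rewrite /above_bound; lia.
(* If the point [s + t] lies in [A], the core splits into the faces avoiding it, again a core, and
   the faces containing it. Otherwise there is a gap. *)
case: (pickP (fun u : 'I_n => (u == s + t :> nat)%N && (u \in A))) => [u|noA].
  case/andP => /eqP us uA.
  pose S := pack_core t s A k.+1; pose S1 := [set F in S | u \notin F].
  have memS1 F : (F \in S1) = (F \in S) && (u \notin F) by rewrite [LHS]inE.
  have idS1 : ideal_of S1 S.
    split=> [F|F G]; rewrite !memS1; first by case/andP.
    move=> /andP[_ uF] -> GF /=.
    by apply: contra uF; apply: (subsetP GF).
  have un := ltn_ord u; rewrite us in un.
  have m_gt0 : (0 < m)%N by lia.
  apply: (acyclic_at_union (pack_core_convex t_gt0 (s:=s) (A:=A) (k:=k.+1)) idS1).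
    rewrite /S1 /S (pack_core_avoid t_gt0 k blk us uA) us.
    apply: IHcore us uA _; first lia.
    rewrite /above_bound; case: ltnP => //= lk.
    by have := leray_bound_block (n - s) k t_gt0; rewrite subnDA; lia.
  (* Deleting [u] lowers the degree by 1; beyond [u], the complex with [k] blocks is needed in
     degree [m.-1] and its subcomplex with [k.+1] blocks in degree [m.-1.-1]. *)
  rewrite -(prednK m_gt0); apply: (@acyclic_at_shift _ _ _ u) => [F|].
    by rewrite in_setD memS1 negb_and negbK => /andP[/orP[/negPf->|]].
  rewrite [X in acyclic_at _ X](_ : _ = [set F : {set 'I_n} | (u \notin F) && (u |: F \in S)]).
    rewrite /S (pack_core_meet t_gt0 k blk us uA) us.
    by apply: acyclic_pack_diff; [apply: IHcpx (ab_meet _); lia|apply: IHcpx ab_loop; lia].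
  apply/setP => F; rewrite [LHS]inE [RHS]inE; congr (_ && _).
  by rewrite in_setD memS1 setU11 andbF.
rewrite pack_core_gap //; last first.
  by move=> j jst; have := noA j; rewrite jst eqxx => /negbT.
by apply: acyclic_pack_diff; [apply: IHcpx ab_meet'; lia|apply: IHcpx ab_loop'; lia].
Qed.

Lemma acyclic_pack_complex s A k m : above_bound (n - s) k m ->
  acyclic_at K (pack_complex t s A k) m.
Proof.
have [l] := ubnP (n - s); elim: l s k m => // l IHl s k m sl ab.
have [ns|sn] := leqP n s; first exact: acyclic_pack_complex_end.
have IHcpx s' : (s < s')%N -> forall k m,
    above_bound (n - s') k m -> acyclic_at K (pack_complex t s' A k) m.
  by move=> ss' k' m'; apply: IHl; lia.
case: (boolP (Ordinal sn \in A)) => sA; last first.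
  rewrite pack_complex_succ //; last first.
    by move=> j js; rewrite (_ : j = Ordinal sn) //; apply: val_inj.
  apply: IHcpx => //; move: ab; rewrite /above_bound subnS.
  have := @leray_bound_skip t (n - s) k t_gt0; lia.
apply: (@pack_complex_core _ _ _ _ (Ordinal sn)) => //.
(* A core refers both to complexes and to cores further right; a nested induction on cores supplies
   the latter. *)
clear IHl; have [l' sl'] := ubnP (n - s).
elim: l' s k m {sl} sl' ab sn IHcpx {sA} => // l' IHl' s k m sl' ab sn IHcpx.
apply: acyclic_pack_core => // s' ss' u k' m' us' uA ab'.
have s'n : (s' < n)%N by rewrite -us'.
by apply: IHl' => //; [lia | move=> s'' ss''; apply: IHcpx; lia].
Qed.

End UpperBound.

(** * Links and the path complex *)

Section LerayLinks.
Variables (K : fieldType) (n : nat).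
Implicit Types (F G H A W : {set 'I_n}) (m d : nat) (D : simplicial_complex n).
Implicit Types (c : chain K n).

Lemma chains_of_cardP D m c : reflect (supported D m c) (c \in chains_of_card K D m).
Proof.
apply: (iffP idP) => [/memv_sumP[c_ c_F ->] F|cD].
  rewrite sum_ffunE; apply: contraNT => FD; rewrite big1 // => G GD.
  have /vlineP[a ->] := c_F G GD; rewrite !ffunE; case: eqP => [FG|_].
    by rewrite FG GD in FD.
  by rewrite /GRing.scale /= mulr0.
have -> : c = \sum_(F | (F \in faces D) && (#|F| == m)) (c F : K) *: basis_chain K F.
  apply/ffunP => G; rewrite sum_ffunE.
  under eq_bigr => F _ do rewrite !ffunE /GRing.scale /=.
  case: (boolP ((G \in faces D) && (#|G| == m))) => GD.
    rewrite (bigD1 G) //= eqxx mulr1 big1 ?addr0 // => F /andP[_ FG].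
    by rewrite eq_sym (negPf FG) mulr0.
  rewrite big1 => [|F FD]; first by apply/eqP; apply: contraNT GD => /cD.
  by case: eqP => [GF|_]; [rewrite GF FD in GD|rewrite mulr0].
by apply: memv_sumr => F _; rewrite memvZ ?memv_line.
Qed.

Lemma subset_setCU1 v A F : (F \subset ~: (v |: A)) = (v \notin F) && (F \subset ~: A).
Proof. by rewrite setCU subsetI -disjoints_subset disjoint_sym disjoints1. Qed.

Lemma cyclesP D (i : nat) c :
  reflect (supported D i.+1 c /\ boundary c = 0) (c \in cycles K D i).
Proof.
rewrite memv_cap memv_ker lfunE /=.
by apply: (iffP andP) => -[/chains_of_cardP cD /eqP bc].
Qed.

(** Testing boundaries on [D] alone is enough: the boundary of a chain supported on [D] vanishes off
    [D], by closure under subsets. *)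
Lemma reduced_homology_vanishesP D (i : nat) :
  reduced_homology_vanishes K D i <-> acyclic_at K D i.+1.
Proof.
have bout c m G : supported D m c -> G \notin faces D -> boundary c G = 0.
  move=> cD; apply: contraNeq => /boundary_coface[v vG /cD/andP[vD _]].
  exact: faces_down (subsetUr _ _) vD.
split=> [/subvP hD c cD bc|acD].
  have /hD/memv_imgP[e /chains_of_cardP eD ceq] : c \in cycles K D i.
    apply/cyclesP; split=> //; apply/ffunP => G; rewrite [RHS]ffunE.
    by case: (boolP (G \in faces D)) => [/bc|/(bout _ _ _ cD)].
  by exists e => // G _; rewrite ceq lfunE.
apply/subvP => c /cyclesP[cD bc]; apply/memv_imgP.
have [|e eD be] := acD c cD; first by move=> G _; rewrite bc ffunE.
exists e; first exact/chains_of_cardP.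
apply/ffunP => G; rewrite lfunE /=.
case: (boolP (G \in faces D)) => [/be->//|GD].
by rewrite (bout _ _ _ eD) // (supported0 cD).
Qed.

(** This interpolates between links, where [B] is empty, and induced subcomplexes, where [A] is
    empty and [B] is the complement of [W]. *)
Definition link_avoiding D A B : {set {set 'I_n}} :=
  [set F : {set 'I_n} | (F \subset ~: (A :|: B)) && (A :|: F \in faces D)].

Lemma link_avoiding_convex D A B : convex_family (link_avoiding D A B).
Proof.
move=> F G H _; rewrite !inE => /andP[HAB HD] _ GH.
by rewrite (subset_trans GH HAB) (faces_down _ HD) ?setUS.
Qed.

(* Deleting a vertex [v] from a link [S] puts the restriction in a long exact sequence with
   [S] and the link of [v] in [S]. *)
Lemma acyclic_link_avoiding D d :
  (forall A m, (d < m)%N -> acyclic_at K (link_avoiding D A set0) m) ->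
  forall B A m, (d < m)%N -> acyclic_at K (link_avoiding D A B) m.
Proof.
move=> acL B; have [j] := ubnP #|B|; elim: j B => // j IHj B Bj A m dm.
have [->|[v vB]] := set_0Vmem B; first exact: acL.
have Bv : (#|B :\ v| < j)%N by move: Bj; rewrite [#|B|](cardsD1 v) vB.
have splitB : B = v |: B :\ v by rewrite setD1K.
case: (boolP (v \in A)) => vA.
  rewrite (_ : link_avoiding D A B = link_avoiding D A (B :\ v)); first exact: IHj.
  apply/setP => F; rewrite !inE (_ : A :|: B = A :|: B :\ v) //.
  by apply/setP => x; rewrite !inE; case: eqP => [->|//]; rewrite vA.
pose S := link_avoiding D A (B :\ v).
have memAB F : (F \in link_avoiding D A B) = (F \in S) && (v \notin F).
  by rewrite !inE {1}splitB setUCA subset_setCU1 -andbA andbC.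
have idS : ideal_of (link_avoiding D A B) S.
  split=> [F|F G]; rewrite !memAB; first by case/andP.
  by move=> /andP[_ vF] -> GF; apply: contra vF; apply: (subsetP GF).
apply: (acyclic_at_ideal (@link_avoiding_convex D A (B :\ v)) idS); first exact: IHj.
apply: (@acyclic_at_shift _ _ _ v) => [F|].
  by rewrite in_setD memAB negb_and negbK => /andP[/orP[/negPf->|]].
rewrite [X in acyclic_at _ X](_ : _ = link_avoiding D (v |: A) (B :\ v)).
  exact: IHj.
apply/setP => F; rewrite [LHS]inE in_setD memAB setU11 andbF /= !inE subUset sub1set.
rewrite !inE (negPf vA) eqxx /= andbA; congr (_ && _); last first.
  by rewrite setUCA setUA.
by rewrite -setUA subset_setCU1.
Qed.

Lemma is_leray_links D d :
  (forall A m, (d < m)%N -> acyclic_at K (link_avoiding D A set0) m) -> is_leray K D d.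
Proof.
move=> acL W i di; apply/reduced_homology_vanishesP.
rewrite (_ : faces (induced D W) = link_avoiding D set0 (~: W)).
  exact: (acyclic_link_avoiding acL).
by apply/setP => F; rewrite !inE !set0U setCK andbC.
Qed.

End LerayLinks.

(** * The dual of the path complex in terms of packings *)

Section PathDual.
Variables (K : fieldType) (n t : nat).
Hypothesis t_gt0 : (0 < t)%N.
Implicit Types (F G A : {set 'I_n}).

Lemma sqfree_monomial_ideal (S : {mpoly K[n]} -> Prop) (T : {set 'I_n} -> Prop) A :
  (forall p, S p <-> exists2 G, T G & p = sqfree_monomial K G) ->
  ideal_gen S (sqfree_monomial K A) <-> exists2 G, T G & G \subset A.
Proof.
move=> ST; split=> [[s [sS Aeq]]|[G TG GA]]; last first.
  exists [:: (sqfree_monomial K (A :\: G), sqfree_monomial K G)]; split.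
    by move=> u; rewrite inE => /eqP->; apply/ST; exists G.
  rewrite big_seq1 /= mulrC /sqfree_monomial (big_setID G) /= (setIidPr GA) //.
have [/existsP[G /andP[/asboolP SG GA]]|noG] :=
  boolP [exists G : {set 'I_n}, `[< T G >] && (G \subset A)].
  by exists G.
(* evaluation at the indicator of [A] sends a squarefree monomial to 1 or 0 according to
   whether its support is contained in [A] *)
pose ev := mmap (@idfun K) (fun i : 'I_n => (i \in A)%:R : K).
have evM G : ev (sqfree_monomial K G) = (G \subset A)%:R.
  rewrite /ev /sqfree_monomial rmorph_prod /=.
  under eq_bigr => i _ do rewrite mmapX mmap1U.
  case: (boolP (G \subset A)) => GA.
    by rewrite big1 // => i /(subsetP GA)->.
  have /subsetPn[i iG iA] := GA.
  by rewrite (bigD1 i) //= (negPf iA) mul0r.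
have := evM A; rewrite subxx Aeq /ev rmorph_sum /= big_seq big1.
  by move/esym/eqP; rewrite oner_eq0.
move=> u us; have /ST[G TG uG] := sS u us.
rewrite rmorphM /= uG [X in _ * X]evM; case: (boolP (G \subset A)) => GA.
  by case/negP: noG; apply/existsP; exists G; rewrite GA andbT; apply/asboolP.
by rewrite mulr0.
Qed.

Definition block a : {set 'I_n} := [set j : 'I_n | (a <= j < a + t)%N].

Lemma packs_starts k s A : packs t k s A ->
  exists f : nat -> nat,
    (forall i, (i < k)%N -> (s <= f i)%N /\ block_in t (f i) A) /\
    (forall i j, (i < j < k)%N -> (f i + t <= f j)%N).
Proof.
elim: k s => [|k IHk] s; first by exists id; split=> // i j; rewrite ltn0 andbF.
case/(packsP t_gt0)=> a [sa blk /IHk[f [fA ff]]].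
exists (fun i => if i is i'.+1 then f i' else a); split=> [[|i] //|[|i] [|j] //].
- by move=> /fA[af blkf]; split=> //; lia.
- by case/andP=> _ /fA[].
- exact: ff.
Qed.

(** Induction on the set of starting points, removing the smallest one as the first block. *)
Lemma packs_set (S : {set 'I_n}) s A :
  (forall x, x \in S -> (s <= x)%N && block_in t x A) ->
  (forall x y, x \in S -> y \in S -> (x < y)%N -> (x + t <= y)%N) ->
  packs t #|S| s A.
Proof.
move: {2}#|S| (erefl #|S|) => k; elim: k S s => [|k IHk] S s Sk SA Ssep.
  by rewrite Sk.
have [x0 x0S] : exists x, x \in S by apply/card_gt0P; rewrite Sk.
case: (arg_minnP (fun x : 'I_n => val x) x0S) => x; rewrite -[_ x]/(x \in S) => xS xmin.
have Sx : #|S :\ x| = k by move: Sk; rewrite (cardsD1 x) xS => -[].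
rewrite Sk; apply/(packsP t_gt0); exists x; have /andP[sx blk] := SA x xS.
split=> //; rewrite -Sx; apply: IHk => // [y|y z].
  rewrite !inE => /andP[yx yS]; have /andP[_ ->] := SA y yS; rewrite andbT.
  by apply: Ssep => //; rewrite ltn_neqAle xmin // andbT eq_sym.
by rewrite !inE => /andP[_ yS] /andP[_ zS]; apply: Ssep.
Qed.

Lemma packsP_supports k A :
  packs t k 0 A <->
  exists F : 'I_k -> {set 'I_n},
    [/\ forall a, F a \in path_supports n t,
        forall a b, a != b -> [disjoint F a & F b] & forall a, F a \subset A].
Proof.
split=> [/packs_starts[f [fA ff]]|[F [supF disF FA]]].
  have fblk (a : 'I_k) : block_in t (f a) A by case: (fA a (ltn_ord a)).
  have sep (a b : 'I_k) : (a < b)%N -> [disjoint block (f a) & block (f b)].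
    move=> ab; rewrite disjoints_subset; apply/subsetP => j; rewrite !inE.
    by have := ff a b; rewrite ab ltn_ord => /(_ isT); lia.
  exists (fun a => block (f a)); split=> [a|a b|a].
  - have le_n : (f a + t <= n)%N by case/andP: (fblk a).
    have lt_n : (f a < n)%N by lia.
    by apply/imsetP; exists (Ordinal lt_n); rewrite ?inE.
  - rewrite -val_eqE neq_ltn => /orP[/sep//|/sep]; by rewrite disjoint_sym.
  - by apply/subsetP => j; rewrite inE; case/block_inP: (fblk a) => _; apply.
have /fin_all_exists[f fF] a : exists x : 'I_n, (x + t <= n)%N /\ F a = block x.
  by have /imsetP[x] := supF a; rewrite inE => xt Fx; exists x.
have memf a : f a \in F a by have [_ ->] := fF a; rewrite inE leqnn; lia.
have injf : injective f.
  move=> a b fab; apply/eqP; apply: contraT => /disF.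
  by move=> /disjointFr/(_ (memf a)); rewrite fab memf.
have cardf : #|[set f a | a : 'I_k]| = k by rewrite card_imset // card_ord.
rewrite -[X in packs _ X]cardf.
apply: packs_set => [_ /imsetP[a _ ->]|_ _ /imsetP[a _ ->] /imsetP[b _ ->] fab].
  have [le_n Fa] := fF a; apply/block_inP; split=> // j fj.
  by apply: (subsetP (FA a)); rewrite Fa inE.
(* Overlapping blocks would both contain the later start [f b]. *)
rewrite leqNgt; apply/negP => fba.
have ab : a != b by apply: contraTneq fab => ->; rewrite ltnn.
have := disjointFr (disF _ _ ab); move/(_ (f b)); rewrite memf.
by case: (fF a) => _ ->; rewrite inE (ltnW fab) fba => /(_ isT).
Qed.

Lemma mem_path_dual_complex k F :
  (F \in faces (path_dual_complex K n t k)) = packs t k 0 (~: F).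
Proof.
have gen A : ideal_gen (@path_sqfree_power_gen K n t k) (sqfree_monomial K A) <->
    packs t k 0 A.
  pose T (G : {set 'I_n}) := exists F : 'I_k -> {set 'I_n},
    [/\ forall a, F a \in path_supports n t,
        forall a b, a != b -> [disjoint F a & F b] & G = \bigcup_a F a].
  have cupE (F' : 'I_k -> {set 'I_n}) : (forall a b, a != b -> [disjoint F' a & F' b]) ->
      \prod_(a < k) sqfree_monomial K (F' a) = sqfree_monomial K (\bigcup_a F' a).
    by move=> dis; rewrite /sqfree_monomial partition_disjoint_bigcup.
  rewrite (@sqfree_monomial_ideal _ T) ?packsP_supports.
    split=> [[_ [F' [supF disF ->]] FA]|[F' [supF disF FA]]].
      by exists F'; split=> // a; apply: subset_trans FA; apply: bigcup_sup.
    by exists (\bigcup_a F' a); [exists F'|apply/bigcupsP].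
  move=> p; split=> [[F' [supF disF ->]]|[_ [F' [supF disF ->]] ->]].
    by exists (\bigcup_a F' a); [exists F'|exact: cupE].
  by exists F'; split=> //; rewrite cupE.
apply/imsetP/idP => [[A]|pk].
  by rewrite !inE negbK => /asboolP/gen pk ->; rewrite setCK.
by exists (~: F); rewrite ?setCK // !inE negbK; apply/asboolP/gen.
Qed.

Lemma link_path_dual_complex k A :
  link_avoiding (path_dual_complex K n t k) A set0 = pack_complex t 0 (~: A) k.
Proof.
apply/setP => F; rewrite [LHS]inE [RHS]inE mem_path_dual_complex setU0.
rewrite (_ : from 0 (~: A) = ~: A); last by apply/setP => x; rewrite !inE andbT.
by congr (_ && packs _ _ _ _); apply/setP => x; rewrite !inE negb_or andbC.
Qed.

Lemma path_dual_is_leray k :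
  is_leray K (path_dual_complex K n t k) (leray_bound t n k).
Proof.
apply: is_leray_links => A m lt_m; rewrite link_path_dual_complex.
by apply: acyclic_pack_complex => //; rewrite /above_bound subn0 lt_m orbT.
Qed.

End PathDual.

(** * Spheres in induced subcomplexes *)

Section SphereBound.
Variables (K : fieldType) (n t k : nat) (W : {set 'I_n}) (grp priv : 'I_n -> nat).
Implicit Types (F G X : {set 'I_n}).
Hypothesis t_gt0 : (0 < t)%N.
(** [hitW] bounds the dimension of the induced complex on [W]; the private blocks and [grp_sep]
    produce faces; [grp_mono] makes the signs of the sphere cancel. *)
Hypothesis hitW : forall a, (a + t <= n)%N ->
  exists2 x : 'I_n, x \in W & (a <= x < a + t)%N.
Hypothesis privW : forall x, x \in W -> (priv x + t <= n)%N /\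
  forall y : 'I_n, y \in W -> (priv x <= y < priv x + t)%N -> y = x.
Hypothesis grp_lt : forall x, x \in W -> (grp x < k)%N.
Hypothesis grp_surj : forall j : 'I_k, exists2 x, x \in W & grp x = j.
Hypothesis grp_sep : forall x y, x \in W -> y \in W -> (grp x < grp y)%N ->
  (priv x + t <= priv y)%N.
Hypothesis grp_mono : forall x y : 'I_n, x \in W -> y \in W -> (x <= y)%N ->
  (grp x <= grp y)%N.

Definition missing X (j : 'I_k) : nat := #|[set x in X | grp x == j]|.

Definition sphere_face F := (F \subset W) && [forall j, missing (W :\: F) j == 1%N].

(* The join of the boundaries of the [k] simplices spanned by the fibres of [grp] on [W]. *)
Definition sphere_chain : chain K n :=
  [ffun F : {set 'I_n} =>
     if sphere_face F then \prod_(u in W :\: F) insertion_sign K W u else 0].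

Lemma missingD1 X v j : v \in X ->
  missing X j = ((grp v == j) + missing (X :\ v) j)%N.
Proof.
move=> vX; rewrite /missing (cardsD1 v) !inE vX; congr (_ + _)%N.
by apply: eq_card => x; rewrite !inE andbA.
Qed.

Lemma sphere_face_card F : sphere_face F -> #|W :\: F| = k.
Proof.
case/andP=> FW /forallP oneF; rewrite -[RHS]card_ord -sum1_card -[RHS]sum1_card.
transitivity (\sum_(x in W :\: F) \sum_(j < k) (grp x == j))%N.
  apply: eq_bigr => x; rewrite inE => /andP[_ xW].
  rewrite (bigD1 (Ordinal (grp_lt xW))) //= eqxx big1 // => j.
  by rewrite -val_eqE /= eq_sym => /negPf->.
rewrite exchange_big; apply: eq_bigr => j _; rewrite -(eqP (oneF j)) /missing.
rewrite -sum1_card big_mkcond [RHS]big_mkcond /=; apply: eq_bigr => x _.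
by rewrite !inE; case: ifP => _ //=; case: eqP.
Qed.

Lemma packs_sphere_face F : sphere_face F -> packs t k 0 (~: F).
Proof.
case/andP=> FW /forallP oneF.
(* Induction on the number [i] of remaining groups, numbered from [k - i] on; each contributes the
   private block of its missing point. *)
suff claim i s : (i <= k)%N ->
    (forall x, x \in W -> (k - i <= grp x)%N -> (s <= priv x)%N) -> packs t i s (~: F).
  exact: claim.
elim: i s => [//|i IHi] s ik sW.
have ki : (k - i.+1 < k)%N by lia.
have /card_gt0P[x] : (0 < missing (W :\: F) (Ordinal ki))%N by rewrite (eqP (oneF _)).
rewrite !inE /= => /andP[/andP[xF xW] /eqP gx]; have [le_n privx] := privW xW.
apply/(packsP t_gt0); exists (priv x); split; first by apply: sW => //; rewrite gx.
  apply/block_inP; split=> // y xy; rewrite inE; apply: contra xF => yF.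
  by rewrite -(privx y (subsetP FW y yF) xy).
apply: IHi; first exact: ltnW.
by move=> y yW gy; apply: grp_sep => //; rewrite gx; lia.
Qed.

Lemma card_packs_hit k' s F : packs t k' s (~: F) ->
  (k' <= #|[set x in W :\: F | (s <= x)%N]|)%N.
Proof.
elim: k' s => [//|k' IHk] s /(packsP t_gt0)[a [sa /block_inP[le_n blk] /IHk le_k]].
have [x xW xa] := hitW le_n; have xF := blk x xa; rewrite inE in xF.
rewrite (cardsD1 x) !inE xF xW (leq_trans sa) ?(andP xa).1 //= ltnS.
apply: leq_trans le_k _; apply: subset_leq_card; apply/subsetP => y.
rewrite !inE => /andP[-> ay]; rewrite (_ : (s <= y)%N) ?andbT; last lia.
by apply: contraTneq ay => ->; lia.
Qed.

Lemma sphere_face_ex : exists F, sphere_face F.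
Proof.
have /fin_all_exists2[x xW gx] : forall j : 'I_k, exists2 x, x \in W & grp x = j := grp_surj.
pose X := [set x j | j : 'I_k]; exists (W :\: X); rewrite /sphere_face subsetDl.
have -> : W :\: (W :\: X) = X.
  rewrite setDDr setDv set0U; apply/setIidPr/subsetP => _ /imsetP[j _ ->] //.
apply/forallP => j; apply/eqP; rewrite /missing -(cards1 (x j)).
apply: eq_card => y; rewrite !inE; apply/andP/eqP => [[/imsetP[i _ ->] /eqP]|->].
  by rewrite gx => /val_inj->.
by rewrite gx eqxx imset_f.
Qed.

Lemma insertion_sign_setD G v : G \subset W ->
  insertion_sign K W v = insertion_sign K G v * insertion_sign K (W :\: G) v.
Proof.
move=> GW; rewrite /insertion_sign -exprD; congr (_ ^+ _).
rewrite -(cardsID G); congr (_ + _)%N; apply: eq_card => x; rewrite !inE.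
  by case: (boolP (x \in G)) => [/(subsetP GW)->|]; rewrite ?andbF ?andbT.
by rewrite andbA.
Qed.

(** A set with a coface in the sphere misses two points of one group and one point of every other
    group. Exactly two cofaces contribute, with opposite signs. *)
Lemma boundary_sphere_chain G : boundary sphere_chain G = 0.
Proof.
rewrite boundaryE.
have [/exists_inP[v0 v0G sph0]|/exists_inPn nosph] :=
  boolP [exists v in ~: G, sphere_face (v |: G)]; last first.
  apply: big1 => v vG; rewrite ffunE; case: ifP => sph; last by rewrite mulr0.
  by have := nosph v; rewrite inE vG sph => /(_ isT).
have /andP[vGW /forallP one0] := sph0; rewrite inE in v0G.
move: vGW; rewrite subUset sub1set => /andP[v0W GW].
pose M := W :\: G; have v0M : v0 \in M by rewrite inE v0G.
have DU v : W :\: (v |: G) = M :\ v by rewrite setUC -setDDl.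
pose j0 := Ordinal (grp_lt v0W).
have missM j : missing M j = (j == j0).+1.
  by rewrite (missingD1 _ v0M) -DU (eqP (one0 j)) addn1 -val_eqE eq_sym.
have sphE v : v \notin G ->
    sphere_face (v |: G) = (v \in [set x in M | grp x == j0]).
  move=> vG; rewrite /sphere_face subUset sub1set GW andbT !inE vG /=.
  case: (boolP (v \in W)) => //= vW; have vM : v \in M by rewrite inE vG.
  apply/forallP/eqP => [one|gv j].
    have := missM (Ordinal (grp_lt vW)); rewrite (missingD1 _ vM) -DU (eqP (one _)).
    by rewrite eqxx => -[]; case: eqP => // /(congr1 val).
  have := missM j; rewrite (missingD1 _ vM) -DU gv (_ : (val j0 == j) = (j == j0)).
    by case: (j == j0) => mj; apply/eqP; lia.
  by rewrite eq_sym.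
have /eqP/cards2P[a [b [ab abE]]] : #|[set x in M | grp x == j0]| = 2%N.
  by have := missM j0; rewrite eqxx.
wlog lt_ab : a b ab abE / (a < b)%N.
  move=> IH; have : val a != val b by [].
  rewrite neq_ltn => /orP[|ba]; first exact: IH.
  by apply: (IH b a); rewrite // 1?eq_sym // abE setUC.
have inM x : x \in [set a; b] -> [/\ x \in M, x \notin G & grp x = j0].
  by rewrite -abE !inE => /andP[/andP[-> ->] /eqP].
have [aM aG ga] := inM a (set21 a b); have [bM bG gb] := inM b (set22 a b).
have term v : v \in [set a; b] -> insertion_sign K G v * sphere_chain (v |: G) =
    insertion_sign K M v * \prod_(u in M) insertion_sign K W u.
  move=> vab; have [vM vG _] := inM v vab.
  rewrite ffunE sphE // abE vab DU [in RHS](bigD1 v) //= (insertion_sign_setD _ GW).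
  rewrite -/M !mulrA [insertion_sign K M v * _]mulrC -!mulrA; congr (_ * _).
  rewrite mulrA insertion_sign_sq mul1r; apply: eq_bigl => u; rewrite in_setD1 andbC //.
rewrite (bigD1 a) //= (bigD1 b) ?bG 1?eq_sym //= big1 ?addr0; last first.
  move=> v /andP[/andP[vG va] vb]; rewrite ffunE sphE // abE !inE.
  by rewrite (negPf va) (negPf vb) mulr0.
rewrite !term ?set21 ?set22 // -mulrDl.
(* By monotonicity of [grp], no missing point lies strictly between [a] and [b], so exactly one more
   missing point precedes [b] than [a]. *)
rewrite (_ : insertion_sign K M b = - insertion_sign K M a) ?addrN ?mul0r //.
rewrite /insertion_sign -[RHS]mulN1r -exprS; congr (_ ^+ _).
rewrite (cardsD1 a) inE aM lt_ab add1n; congr _.+1; apply: eq_card => x.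
rewrite !inE; case: (boolP (x \in G)); rewrite ?andbF //= => xG.
case: (boolP (x \in W)); rewrite ?andbF //= => xW; case: (ltngtP x a) => xa.
- by rewrite (ltn_trans xa lt_ab) andbT; apply: contraTneq xa => ->; rewrite ltnn.
- apply/negP => /andP[xna xb].
  have xM : x \in [set a; b].
    have aW : a \in W by move: aM; rewrite inE => /andP[].
    have bW : b \in W by move: bM; rewrite inE => /andP[].
    rewrite -abE !inE xG xW /= eqn_leq.
    have := grp_mono aW xW (ltnW xa); have := grp_mono xW bW (ltnW xb).
    by rewrite ga gb => -> ->.
  by move: xM xb; rewrite !inE (negPf xna) => /eqP->; rewrite ltnn.
- by rewrite (val_inj xa) eqxx.
Qed.

Lemma leray_ge_sphere d : is_leray K (path_dual_complex K n t k) d -> (#|W| - k <= d)%N.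
Proof.
move=> lerD; rewrite leqNgt; apply/negP => dW.
have [F0 sph0] := sphere_face_ex.
have memI F : (F \in faces (induced (path_dual_complex K n t k) W)) =
    packs t k 0 (~: F) && (F \subset W) by rewrite inE mem_path_dual_complex.
pose i := (#|W| - k).-1.
have di : (d <= i)%N by rewrite /i; lia.
have /reduced_homology_vanishesP acW := lerD W i di.
have [F|G _|e eW be] := acW sphere_chain.
- rewrite ffunE; case: ifP => [sphF _|]; last by rewrite eqxx.
  rewrite memI (packs_sphere_face sphF); have /andP[FW _] := sphF.
  rewrite FW /= /i prednK; last lia.
  by rewrite -(sphere_face_card sphF) cardsD (setIidPr FW) subKn // subset_leq_card.
- exact: boundary_sphere_chain.
(* A filling would need faces with [#|W| - k + 1] points, but each face misses at least [k] points
   of [W]. *)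
have e0 : e = 0.
  apply/ffunP => F; rewrite [RHS]ffunE; apply/eqP; apply/negPn/negP => /eW.
  rewrite memI => /andP[/andP[pk FW] /eqP cF].
  have := card_packs_hit pk; rewrite (_ : [set _ in _ | _] = W :\: F); last first.
    by apply/setP => x; rewrite !inE andbT.
  by have := subset_leq_card FW; rewrite cardsD (setIidPr FW) cF /i; lia.
have F0W : F0 \in faces (induced (path_dual_complex K n t k) W).
  by rewrite memI packs_sphere_face //; case/andP: sph0.
have := be F0 F0W; rewrite e0 linear0 !ffunE sph0 => /eqP.
rewrite eq_sym; apply/negP/prodf_neq0 => u _.
by rewrite /insertion_sign signr_eq0.
Qed.

End SphereBound.

(** * Block decompositions *)

Section BlockDecomposition.
Variables (t A B : nat).
Hypothesis t_gt0 : (0 < t)%N.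

(* [0, A * t + B * (t + 1)) is cut into [A] blocks of length [t] followed by [B] blocks of
   length [t + 1]; [corner] lists the last elements of the former and both ends of the latter. *)
Definition corner (i : 'I_A + 'I_B * bool) : nat :=
  match i with
  | inl j => (j * t + t.-1)%N
  | inr (j, e) => (A * t + j * t.+1 + e * t)%N
  end.

Definition corner_block (i : 'I_A + 'I_B * bool) : nat :=
  match i with inl j => j | inr (j, _) => (A + j)%N end.

(** Start of the private block of a corner: dropping one end of a block of length [t + 1] leaves [t]
    points containing only the other end. *)
Definition corner_start (i : 'I_A + 'I_B * bool) : nat :=
  match i with
  | inl j => (j * t)%N
  | inr (j, e) => (A * t + j * t.+1 + e)%N
  end.

Lemma corner_start_le i : (corner_start i <= corner i < corner_start i + t)%N.
Proof. by case: i => [j|[j []]] /=; lia. Qed.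

Lemma corner_end i : (corner_start i + t <= A * t + B * t.+1)%N.
Proof.
case: i => [j|[j e]] /=.
  by have := leq_mul (ltn_ord j) (leqnn t); lia.
by have := leq_mul (ltn_ord j) (leqnn t.+1); case: e => /=; lia.
Qed.

Lemma corner_start_sep i i' : (corner_block i < corner_block i')%N ->
  (corner_start i + t <= corner_start i')%N.
Proof.
case: i i' => [j|[j e]] [j'|[j' e']] /=.
- by move=> jj'; have := leq_mul jj' (leqnn t); lia.
- by move=> _; have := leq_mul (ltn_ord j) (leqnn t); lia.
- by have := ltn_ord j'; lia.
rewrite ltn_add2l => jj'; have := leq_mul jj' (leqnn t.+1).
by case: e; case: e' => /=; lia.
Qed.

Lemma corner_private i i' :
  (corner_start i <= corner i' < corner_start i + t)%N -> i' = i.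
Proof.
move=> ii'; have start' := corner_start_le i'.
have eq_block : corner_block i' = corner_block i.
  by case: (ltngtP (corner_block i') (corner_block i)) => // /corner_start_sep; lia.
case: i i' ii' {start'} eq_block => [j|[j e]] [j'|[j' e']] /=.
- by move=> _ /val_inj->.
- by have := ltn_ord j; lia.
- by have := ltn_ord j'; lia.
move=> ii' /addnI/val_inj jj'; rewrite jj' in ii' *.
by case: e e' ii' => [] [] //=; lia.
Qed.

(** As [d < t], the window starts inside one of the cut blocks. It reaches the last point of that
    block, unless it starts at the left end of a long block, itself a corner. *)
Lemma corner_hit a d : (d < t)%N -> (a + t <= A * t + B * t.+1 + d)%N ->
  exists i, (a <= corner i < a + t)%N.
Proof.
move=> dt ad; case: (ltnP a (A * t)) => aA.
  have jA : (a %/ t < A)%N by rewrite ltn_divLR.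
  exists (inl (Ordinal jA)) => /=; rewrite {2 4}(divn_eq a t).
  by have := ltn_pmod a t_gt0; lia.
pose q := ((a - A * t) %/ t.+1)%N; pose r := ((a - A * t) %% t.+1)%N.
have a_eq : (a = A * t + q * t.+1 + r)%N by rewrite -addnA -divn_eq subnKC.
have rt : (r < t.+1)%N by rewrite ltn_pmod.
have qB : (q < B)%N.
  rewrite -(ltn_pmul2r (ltn0Sn t)); lia.
exists (inr (Ordinal qB, (0 < r)%N)) => /=.
by case: (posnP r) => r0 /=; lia.
Qed.

End BlockDecomposition.

Lemma leray_ge_blocks (K : fieldType) (n t k A B d r : nat) :
  (0 < t)%N -> (0 < k)%N -> (k <= A + B)%N -> (d < t)%N ->
  n = (A * t + B * t.+1 + d)%N ->
  is_leray K (path_dual_complex K n t k) r -> (A + 2 * B - k <= r)%N.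
Proof.
move=> t_gt0 k_gt0 kAB dt n_eq.
pose T := ('I_A + 'I_B * bool)%type.
have wn (i : T) : (corner t i < n)%N.
  by have := corner_end t_gt0 i; have := corner_start_le t_gt0 i; lia.
pose w (i : T) : 'I_n := Ordinal (wn i).
have w_inj : injective w.
  move=> i i' /(congr1 val) /= wii'; apply: (corner_private t_gt0).
  by rewrite wii' corner_start_le.
have blk_ex j : (j < k)%N -> exists i : T, corner_block i = j.
  move=> jk; case: (ltnP j A) => jA; first by exists (inl (Ordinal jA)).
  have jB : (j - A < B)%N by lia.
  by exists (inr (Ordinal jB, true)); rewrite /= subnKC.
have [i0 _] := blk_ex 0%N k_gt0.
(* [grp] and [priv] must be total, so [w] is inverted with [i0] as the value outside [W]. *)
pose winv x := odflt i0 [pick i | w i == x].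
have wK : cancel w winv.
  move=> i; rewrite /winv; case: pickP => [i' /eqP/w_inj//|/(_ i)].
  by rewrite eqxx.
pose W := [set w i | i : T].
have cardW : #|W| = (A + 2 * B)%N.
  by rewrite card_imset // card_sum card_prod !card_ord card_bool mulnC.
(* The first [k - 1] blocks are groups of their own, and all later blocks are merged into the last
   group. *)
rewrite -cardW; apply: (leray_ge_sphere (grp := fun x => minn (corner_block (winv x)) k.-1)
  (priv := fun x => corner_start t (winv x))) => //.
- move=> a le_n; have [|i ai] := @corner_hit t A B t_gt0 a d dt; first lia.
  by exists (w i); rewrite ?imset_f.
- move=> _ /imsetP[i _ ->]; rewrite wK; split.
    by have := corner_end t_gt0 i; lia.
  by move=> _ /imsetP[i' _ ->] /= /(corner_private t_gt0)->.
- by move=> x _; lia.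
- move=> j; have [i ij] := blk_ex j (ltn_ord j).
  exists (w i); rewrite ?imset_f // wK ij; have := ltn_ord j; lia.
- move=> _ _ /imsetP[i _ ->] /imsetP[i' _ ->]; rewrite !wK => ii'.
  by apply: corner_start_sep; lia.
move=> _ _ /imsetP[i _ ->] /imsetP[i' _ ->] /=; rewrite !wK => ii'.
case: (leqP (corner_block i) (corner_block i')) => [|/(corner_start_sep t_gt0)]; first lia.
by have := corner_start_le t_gt0 i; have := corner_start_le t_gt0 i'; lia.
Qed.

(** * Evaluation of the bound and the closed formulas *)

Lemma leray_number_eq (K : fieldType) n (D : simplicial_complex n) d :
  is_leray K D d -> (forall r, is_leray K D r -> (d <= r)%N) -> leray_number K D = d.
Proof.
move=> lerD minD; rewrite /leray_number; case: ex_minnP => r /asboolP lerR minR.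
by apply/eqP; rewrite eqn_leq minD // minR //; apply/asboolP.
Qed.

Lemma leray_bound_small t l k : (k * t <= l)%N -> (l <= k * t.+1)%N ->
  leray_bound t l k = (l - k * t)%N.
Proof.
by move=> kl lk; rewrite /leray_bound leq_subLR; rewrite mulnS addnC in lk; rewrite lk.
Qed.

Lemma leray_step_mod t q d : (d <= t)%N ->
  leray_step t (q * t.+1 + d) = (2 * q + (d == t))%N.
Proof.
move=> dt; rewrite /leray_step -addnS !divnMDl // divn_small //.
by case: eqP => [->|/eqP dt']; rewrite ?divnn ?divn_small //; lia.
Qed.

Lemma leray_bound_large t q d k : (0 < t)%N -> (d <= t)%N -> (k <= q)%N ->
  leray_bound t (q * t.+1 + d) k = (2 * q - k + (d == t))%N.
Proof.
move=> t_gt0 dt kq; rewrite /leray_bound.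
have y_eq : (q * t.+1 + d - k * t = (q - k) * t.+1 + d + k)%N.
  by rewrite mulnBl; have := leq_mul kq (leqnn t.+1); lia.
rewrite y_eq addnK leray_step_mod //; case: leqP => qk; last lia.
(* The first branch of the bound remains only for [q = k] and [d = 0], where both sides equal
   [k]. *)
move: qk; rewrite -{3}[k]add0n leq_add2r leqn0.
by rewrite addn_eq0 muln_eq0 orbF => /andP[/eqP qk0 /eqP->]; rewrite qk0 mul0n; case: eqP; lia.
Qed.

Theorem corollary4p3 (K : fieldType) (n k t : nat)
    (ht : (1 <= t)%N) (hk : (1 <= k)%N) (hn : (k * t <= n)%N) :
  let L : rat := (leray_number K (path_dual_complex K n t k))%:R in
  [/\ (k * t <= n <= k * (t + 1))%N -> L = n%:R - k%:R * t%:R,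
      forall d : nat, (0 <= d <= t - 1)%N -> n = d %[mod t + 1] ->
        (k * (t + 1) < n)%N ->
        L = 2 * (n%:R - d%:R) / (t%:R + 1) - k%:R
    & n = t %[mod t + 1] -> (k * (t + 1) < n)%N ->
        L = 2 * (n%:R + 1) / (t%:R + 1) - k%:R - 1].
Proof.
move=> L.
have L_eq l : leray_bound t n k = l ->
    (exists A B d, [/\ (k <= A + B)%N, (d < t)%N, n = (A * t + B * t.+1 + d)%N
                     & (A + 2 * B - k = l)%N]) ->
    L = l%:R.
  move=> <- [A [B [d [kAB dt n_eq sum_eq]]]]; congr _%:R; apply: leray_number_eq.
    exact: path_dual_is_leray.
  by move=> r; rewrite -sum_eq; apply: leray_ge_blocks kAB dt n_eq.
have t1_neq0 : (t%:R + 1 : rat) != 0 by rewrite natr1 Num.Theory.pnatr_eq0.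
have n_div d : (d <= t)%N -> n = d %[mod t.+1] -> n = (n %/ t.+1 * t.+1 + d)%N.
  by move=> dt nd; rewrite {1}(divn_eq n t.+1) nd modn_small.
have le_div : (k * t.+1 < n)%N -> (k <= n %/ t.+1)%N by move=> ?; rewrite leq_divRL // ltnW.
rewrite addn1; split=> [/andP[_ le_n]|d /andP[_ dt] nd lt_n|nt lt_n].
- rewrite (L_eq (n - k * t)%N); first by rewrite natrB // natrM.
    exact: leray_bound_small.
  have le_k : (n - k * t <= k)%N by lia.
  (* Exactly [k] blocks cover the whole path, with one long block for each point in excess of
     [k * t]. *)
  exists (k - (n - k * t))%N, (n - k * t)%N, 0%N; split; [lia|by []| |lia].
  by rewrite mulnBl; have := leq_mul le_k (leqnn t); lia.
- have {}dt : (d < t)%N by lia.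
  have n_eq := n_div d (ltnW dt) nd; have kq := le_div lt_n.
  set q := (n %/ t.+1)%N in n_eq kq.
  rewrite (L_eq (2 * q - k)%N).
  + rewrite n_eq natrD addrK natrM -[t.+1%:R]natr1 mulrA mulfK // natrB ?natrM //; lia.
  + by rewrite n_eq leray_bound_large ?(ltnW dt) // ltn_eqF ?addn0.
  + by exists 0%N, q, d; split.
have n_eq := n_div t (leqnn t) nt; have kq := le_div lt_n.
set q := (n %/ t.+1)%N in n_eq kq.
rewrite (L_eq (2 * q - k + 1)%N).
- rewrite n_eq natr1 -addnS -mulSnr natrM -[t.+1%:R]natr1 mulrA mulfK //.
  by rewrite natrD natrB ?natrM -?[q.+1%:R]natr1; [ring|lia].
- by rewrite n_eq leray_bound_large // eqxx.
(* The remainder [t] is itself a short block, which gives one more corner. *)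
by exists 1%N, q, 0%N; split=> //; lia.
Qed.
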